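(* Let $n\geq k\geq 2$ be integers. Then $$e^{(k)}_{n}=\frac{1}{2(2k)^{k}-(k+1)^{k+1}}\sum_{j=0}^{k-1}(nA_{j}+B_{j})F_{n+j}^{(k)},$$ where for $0\leq j\leq k-1$, $$A_{j}=(2k)^{k}-k(k+1)^{k}+(k-1)(k+1)^{j}(2k)^{k-j-1},$$ $$B_{j}=(2k)^{k-j-1}(k+1)^{j}\left(3k+(k-1)j-1\right)-k(k+1)^{k}.$$
   Context: For $n\geq 1$ and $k\geq 2$, the hypercube $Q_n$ is the graph whose vertices are the binary strings of length $n$, two strings adjacent iff they differ in exactly one coordinate. The $k$-th order Fibonacci cube $\Gamma^{(k)}_n$ is the subgraph of $Q_n$ induced by the binary strings of length $n$ that do not contain $k$ consecutive 1s. Let $e^{(k)}_n=|E(\Gamma^{(k)}_n)|$ denote its number of edges. The $k$-th order Fibonacci numbers are defined by $F_0^{(k)}=\cdots=F_{k-2}^{(k)}=0$, $F_{k-1}^{(k)}=1$, and $F_n^{(k)}=F_{n-1}^{(k)}+F_{n-2}^{(k)}+\cdots+F_{n-k}^{(k)}$ for $n\geq k$. *)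

(* Defs.v *)
From mathcomp Require Import all_boot all_order all_algebra.

Set Implicit Arguments.
Unset Strict Implicit.
Unset Printing Implicit Defensive.

Import GRing.Theory.

Definition hypercube_adj (n : nat) : rel (n.-tuple bool) :=
  fun u v => #|[set i : 'I_n | tnth u i != tnth v i]| == 1.

(* Binary strings with no k consecutive 1s; [infix] is contiguous. *)
Definition fibcube_vertices (k n : nat) : {set n.-tuple bool} :=
  [set u : n.-tuple bool | ~~ infix (nseq k true) u].

(* Edges are unordered pairs, so each edge is counted once. *)
Definition induced_edges (T : finType) (adj : rel T) (V : {set T}) :
    {set {set T}} :=
  [set [set u; v] | u in V, v in V & adj u v].

Definition fibcube_edges (k n : nat) : {set {set n.-tuple bool}} :=
  induced_edges (@hypercube_adj n) (fibcube_vertices k n).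

(* The value at index [size s], given all earlier values in [s], most recent
   first. *)
Definition kfib_next (k : nat) (s : seq nat) : nat :=
  if size s < k.-1 then 0
  else if size s == k.-1 then 1
  else sumn (take k s).

Fixpoint kfib_below (k n : nat) : seq nat :=
  if n is m.+1 then kfib_next k (kfib_below k m) :: kfib_below k m else [::].

Definition kfib (k n : nat) : nat := kfib_next k (kfib_below k n).

Lemma size_kfib_below k n : size (kfib_below k n) = n.
Proof. by elim: n => //= n ->. Qed.

Lemma nth_kfib_below k n i :
  i < n -> nth 0 (kfib_below k n) i = kfib k (n - i.+1).
Proof.
elim: n i => // n IHn [|i] /= lt_in; first by rewrite subn1.
by rewrite IHn // subSS.
Qed.

Lemma kfib_small k n : n < k.-1 -> kfib k n = 0.
Proof. by move=> ltnk; rewrite /kfib /kfib_next size_kfib_below ltnk. Qed.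

Lemma kfib_pred k : kfib k k.-1 = 1.
Proof. by rewrite /kfib /kfib_next size_kfib_below ltnn eqxx. Qed.

Lemma kfib_rec k n : 0 < k -> k <= n ->
  kfib k n = \sum_(1 <= i < k.+1) kfib k (n - i).
Proof.
move=> k_gt0 le_kn; have lt_kn : k.-1 < n by rewrite prednK.
rewrite {1}/kfib /kfib_next size_kfib_below ltnNge (ltnW lt_kn) /=.
rewrite gtn_eqF // sumnE (big_nth 0) size_takel ?size_kfib_below //.
rewrite big_add1 /= !big_mkord; apply: eq_bigr => i _.
by rewrite nth_take // nth_kfib_below // (leq_trans (ltn_ord i)).
Qed.

Local Open Scope ring_scope.

Definition edge_coefA (k j : nat) : rat :=
  (2 * k%:R) ^+ k - k%:R * (k%:R + 1) ^+ k
  + (k%:R - 1) * (k%:R + 1) ^+ j * (2 * k%:R) ^+ (k - j - 1).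

Definition edge_coefB (k j : nat) : rat :=
  (2 * k%:R) ^+ (k - j - 1) * (k%:R + 1) ^+ j
    * (3 * k%:R + (k%:R - 1) * j%:R - 1)
  - k%:R * (k%:R + 1) ^+ k.

(* Main.v *)
(* An edge is obtained by clearing a 1 of its larger endpoint, so e_n is the total
   number of 1s in the vertices. Splitting a vertex after its leading block
   1^i 0 gives e_n = sum_(1 <= i <= k) (e_(n-i) + (i-1) F_(n+k-i)), valid for all
   n >= 0 with e_m = 0 for m < 0.  The right-hand side of the formula obeys the
   same recurrence, by summation by parts in H_n = sum_(1 <= i <= k) i F_(n-i),
   which satisfies H_(n+1) - H_n = (k+1) F_(n+1) - 2k F_n.  Once F is extended
   backwards (F_(-1) = 1, F_(-2) = -1, then zeros down to F_(-k)), it also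
   vanishes for -k <= n < 0, so the two sides agree. *)
Require Import Defs.
From mathcomp Require Import all_boot all_order all_algebra.
From mathcomp Require Import zify ring.

Import GRing.Theory.
Local Open Scope ring_scope.

Set Implicit Arguments.
Unset Strict Implicit.

Section Counting.
Local Open Scope nat_scope.

(** * Runs of 1s in words *)

Lemma infix_nseqP (k : nat) (s : bitseq) :
  reflect (exists2 i, i + k <= size s & forall j, j < k -> nth false s (i + j))
          (infix (nseq k true) s).
Proof.
apply: (iffP (@infixP _ (nseq k true) s)) => [[p [q ->]]|[i le_ik s_i]].
  exists (size p); first by rewrite !size_cat size_nseq addnA leq_addr.
  move=> j ltjk; rewrite nth_cat ltnNge leq_addr /= addKn nth_cat size_nseq ltjk.
  by rewrite nth_nseq ltjk.
exists (take i s), (drop (i + k) s).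
rewrite -[LHS](cat_take_drop i); congr (_ ++ _).
rewrite -[LHS](cat_take_drop k) drop_drop addnC; congr (_ ++ _).
have sz : size (take k (drop i s)) = k by rewrite size_takel // size_drop; lia.
apply: (@eq_from_nth _ false); rewrite sz ?size_nseq // => j ltjk.
by rewrite nth_take // nth_drop nth_nseq ltjk s_i.
Qed.

(** The block of 1s is shorter than [k] and a run cannot cross the 0, so it lies inside [w]: reading
    a 0 resets the number of preceding 1s. *)
Lemma infix_nseq_false (k r : nat) (w : bitseq) : r < k ->
  infix (nseq k true) (nseq r true ++ false :: w) = infix (nseq k true) w.
Proof.
have not_prefix j : j < k ->
    prefix (nseq k true) (nseq j true ++ false :: w) = false.
  elim: j {1 2}k => [|j IHj] [|l] //= ltjl.
  exact: IHj.
elim: r => [|r IHr] ltrk; have /= := not_prefix _ ltrk.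
  by move=> ->.
by move=> ->; apply: IHr; apply: ltnW.
Qed.

Lemma infix_nseq_ge (k r : nat) (w : bitseq) : k <= r ->
  infix (nseq k true) (nseq r true ++ w).
Proof.
move=> lekr; apply/infix_nseqP; exists 0; first by rewrite size_cat size_nseq; lia.
by move=> j ltjk; rewrite nth_cat size_nseq nth_nseq (leq_trans ltjk lekr).
Qed.

(** * Recurrences for the number of words and of their 1s *)

Lemma big_tuple_cons (n : nat) (P : pred bitseq) (F : bitseq -> nat) :
  \sum_(w : n.+1.-tuple bool | P w) F w =
  \sum_(w : n.-tuple bool | P (false :: w)) F (false :: w)
  + \sum_(w : n.-tuple bool | P (true :: w)) F (true :: w).
Proof.
rewrite (reindex (fun p : bool * n.-tuple bool => cons_tuple p.1 p.2)) /=; last first.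
  exists (fun w : n.+1.-tuple bool => (thead w, behead_tuple w)).
    by case=> b w _ /=; congr (_, _); apply: val_inj.
  by move=> w _; rewrite [RHS]tuple_eta; apply: val_inj.
rewrite big_mkcond -(pair_bigA _ (fun b (w : n.-tuple bool) =>
  if P (b :: w) then F (b :: w) else 0)) /=.
by rewrite big_bool addnC /= -!big_mkcond.
Qed.

(* [r] is the number of 1s immediately preceding the string. *)
Definition suffix_count (k r n : nat) : nat :=
  \sum_(w : n.-tuple bool | ~~ infix (nseq k true) (nseq r true ++ w)) 1.

Definition suffix_ones (k r n : nat) : nat :=
  \sum_(w : n.-tuple bool | ~~ infix (nseq k true) (nseq r true ++ w)) count id w.

Lemma nseq_true_cons (r : nat) (w : bitseq) :
  nseq r true ++ true :: w = nseq r.+1 true ++ w.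
Proof. by elim: r => //= r ->. Qed.

Lemma suffix_countS (k r n : nat) : r < k ->
  suffix_count k r n.+1 = suffix_count k 0 n + suffix_count k r.+1 n.
Proof.
move=> ltrk; rewrite /suffix_count.
rewrite (@big_tuple_cons n (fun w => ~~ infix _ (_ ++ w)) (fun=> 1)).
congr (_ + _); apply: eq_bigl => w.
  by rewrite infix_nseq_false.
by rewrite nseq_true_cons.
Qed.

Lemma suffix_onesS (k r n : nat) : r < k ->
  suffix_ones k r n.+1 =
  suffix_ones k 0 n + (suffix_ones k r.+1 n + suffix_count k r.+1 n).
Proof.
move=> ltrk; rewrite /suffix_ones /suffix_count.
rewrite (@big_tuple_cons n (fun w => ~~ infix _ (_ ++ w)) (count id)).
rewrite -big_split /=; congr (_ + _); apply: eq_big => w //=.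
- by rewrite infix_nseq_false.
- by rewrite nseq_true_cons.
- by rewrite addnC.
Qed.

Lemma suffix_count_ge (k r n : nat) : k <= r -> suffix_count k r n = 0.
Proof. by move=> lekr; apply: big_pred0 => w; rewrite infix_nseq_ge. Qed.

Lemma suffix_ones_ge (k r n : nat) : k <= r -> suffix_ones k r n = 0.
Proof. by move=> lekr; apply: big_pred0 => w; rewrite infix_nseq_ge. Qed.

Lemma suffix_count0 (k r : nat) : r < k -> suffix_count k r 0 = 1.
Proof.
move=> ltrk; rewrite /suffix_count (eq_bigl xpredT) => [|w].
  by rewrite sum1_card card_tuple expn0.
by rewrite tuple0 cats0; apply/infix_nseqP => -[i]; rewrite size_nseq; lia.
Qed.

Lemma suffix_ones0 (k r : nat) : suffix_ones k r 0 = 0.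
Proof. by apply: big1 => w _; rewrite tuple0. Qed.

(** Reading a 0 contributes a full Fibonacci window, which folds into the leading term; reading a 1
    contributes the remaining terms. At [n = 0] only the index [k.-1] survives. *)
Lemma suffix_countE (k r n : nat) : 0 < k -> r <= k ->
  suffix_count k r n = \sum_(i < k - r) kfib k (n + k.-1 - i).
Proof.
move=> k_gt0; elim: n r => [|n IHn] r.
  rewrite leq_eqVlt => /predU1P[->|ltrk].
    by rewrite suffix_count_ge // subnn big_ord0.
  rewrite suffix_count0 // -(subnSK ltrk) big_ord_recl subn0 add0n kfib_pred.
  by rewrite big1 // => i _; rewrite kfib_small //= /bump; have := ltn_ord i; lia.
rewrite leq_eqVlt => /predU1P[->|ltrk].
  by rewrite suffix_count_ge // subnn big_ord0.
rewrite suffix_countS // !IHn // subn0 -(subnSK ltrk) big_ord_recl subn0.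
congr (_ + _).
rewrite [RHS]kfib_rec //; last by lia.
rewrite big_add1 big_mkord; apply: eq_bigr => i _; congr kfib; lia.
Qed.

(* The value at [m] belongs to the cube of order [m - k], so that the recurrence
   can start from the zero values at negative orders. *)
Definition shifted_ones (k m : nat) : nat :=
  if m < k then 0 else suffix_ones k 0 (m - k).

(** Here [i] is the number of 1s before the first 0: each of the [kfib k (n + k.-1 - i)] completions
    carries these [i] ones besides its own. The word made of 1s only is the case [i = n], where that
    factor is [kfib k k.-1 = 1]. *)
Lemma suffix_onesE (k r n : nat) : 0 < k -> r <= k ->
  suffix_ones k r n =
  \sum_(i < k - r) (shifted_ones k (n + k.-1 - i) + i * kfib k (n + k.-1 - i)).
Proof.
move=> k_gt0; elim: n r => [|n IHn] r.
  move=> _; rewrite suffix_ones0 big1 // => -[[|i] lti] _ /=.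
    by rewrite /shifted_ones; case: ifP => //; lia.
  by rewrite /shifted_ones kfib_small 1?muln0; [case: ifP => //; lia | lia].
rewrite leq_eqVlt => /predU1P[->|ltrk].
  by rewrite suffix_ones_ge // subnn big_ord0.
rewrite suffix_onesS // [suffix_ones k r.+1 n]IHn // suffix_countE //.
rewrite -(subnSK ltrk) big_ord_recl subn0 mul0n addn0.
congr (_ + _).
  rewrite /shifted_ones; have -> : n.+1 + k.-1 = n + k by lia.
  by rewrite ltnNge leq_addl addnK.
rewrite -big_split; apply: eq_bigr => i _ /=.
have -> : n.+1 + k.-1 - bump 0 i = n + k.-1 - i by rewrite /bump; lia.
by rewrite /bump add1n mulSn addnC [_ + i * _ in RHS]addnC addnCA addnC addnAC; lia.
Qed.

Lemma shifted_ones_rec (k n : nat) : 0 < k ->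
  shifted_ones k (n + k) =
  \sum_(i < k) (shifted_ones k (n + k.-1 - i) + i * kfib k (n + k.-1 - i)).
Proof.
move=> k_gt0; have := @suffix_onesE k 0 n k_gt0 isT; rewrite subn0 => <-.
by rewrite /shifted_ones ltnNge leq_addl addnK.
Qed.

(** * Edges as 1s of vertices *)

Section EdgeCount.
Variable n : nat.
Implicit Types (u v : n.-tuple bool) (i j : 'I_n).

Definition clear_bit u i : n.-tuple bool :=
  [tuple (j != i) && tnth u j | j < n].

Lemma tnth_clear_bit u i j : tnth (clear_bit u i) j = (j != i) && tnth u j.
Proof. by rewrite tnth_mktuple. Qed.

(** A run of 1s in [v] occurs at the same place in [u]; hence clearing a bit stays in the cube. *)
Lemma fibcube_vertices_le k u v : (forall i, tnth v i -> tnth u i) ->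
  u \in fibcube_vertices k n -> v \in fibcube_vertices k n.
Proof.
move=> le_vu; rewrite !inE; apply: contra => /infix_nseqP[a le_a va].
apply/infix_nseqP; exists a; first by move: le_a; rewrite !size_tuple.
move=> j ltjk; have lt_n : a + j < n by move: le_a; rewrite size_tuple; lia.
by move: (va j ltjk); rewrite -!(tnth_nth _ _ (Ordinal lt_n)); apply: le_vu.
Qed.

Lemma hypercube_adjP u v :
  reflect (exists i, (tnth u i != tnth v i) /\
                     forall j, j != i -> tnth u j = tnth v j)
          (hypercube_adj u v).
Proof.
apply: (iffP cards1P) => [[i defi]|[i [neq_i eq_j]]]; exists i.
  split=> [|j neq_ji]; first by move: (set11 i); rewrite -defi inE.
  apply/eqP/negPn; apply: contra neq_ji => neq_j.
  by rewrite -in_set1 -defi inE.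
apply/setP=> j; rewrite !inE; have [->|neq_ji] := eqVneq j i; first by [].
by rewrite eq_j ?eqxx.
Qed.

Lemma hypercube_adj_sym : symmetric (@hypercube_adj n).
Proof.
move=> u v; rewrite /hypercube_adj; congr (_ == _); apply: eq_card => i.
by rewrite !inE eq_sym.
Qed.

Lemma hypercube_adj_clear_bit u i : tnth u i -> hypercube_adj u (clear_bit u i).
Proof.
move=> ui; apply/hypercube_adjP; exists i; split=> [|j neq_ji].
  by rewrite tnth_clear_bit eqxx ui.
by rewrite tnth_clear_bit neq_ji.
Qed.

Lemma hypercube_adj_clear u v : hypercube_adj u v ->
  exists i, tnth u i /\ v = clear_bit u i \/ tnth v i /\ u = clear_bit v i.
Proof.
move=> /hypercube_adjP[i [neq_i eq_j]]; exists i.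
case ui: (tnth u i) neq_i; case vi: (tnth v i) => // _; [left|right];
  split=> //; apply: eq_from_tnth => j; rewrite tnth_clear_bit;
  by have [->|/eq_j->] := eqVneq j i.
Qed.

(** Clearing a 1 maps the pairs of a vertex and the position of one of its 1s bijectively onto the
    edges. *)
Lemma card_fibcube_edges k :
  #|fibcube_edges k n| = \sum_(u in fibcube_vertices k n) count id u.
Proof.
pose V := fibcube_vertices k n.
pose ones := [set p : n.-tuple bool * 'I_n | (p.1 \in V) && tnth p.1 p.2].
pose edge (p : n.-tuple bool * 'I_n) := [set p.1; clear_bit p.1 p.2].
have VC u i : u \in V -> clear_bit u i \in V.
  by apply: fibcube_vertices_le => j; rewrite tnth_clear_bit => /andP[].
have -> : fibcube_edges k n = edge @: ones.
  apply/setP=> e; apply/imset2P/imsetP => [[u v uV]|[[u i] /=]].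
    rewrite inE => /andP[vV adj_uv] ->.
    have [i [[ui def_v]|[vi def_u]]] := hypercube_adj_clear adj_uv.
      by exists (u, i); [rewrite inE; apply/andP | rewrite /edge /= def_v].
    by exists (v, i); [rewrite inE; apply/andP | rewrite /edge /= def_u setUC].
  rewrite inE /= => /andP[uV ui] ->.
  exists u (clear_bit u i) => //.
  by rewrite inE VC // hypercube_adj_clear_bit.
rewrite card_in_imset => [|[u i] [v j]]; last first.
  rewrite !inE /edge /= => /andP[_ ui] /andP[_ vj] eq_e.
  (* The edge determines its larger endpoint: otherwise each endpoint would arise from the other by
     clearing a bit, and [v] would be 0 at [j]. *)
  have eq_uv : u = v.
    have: u \in [set v; clear_bit v j] by rewrite -eq_e set21.
    rewrite !inE => /orP[/eqP//|/eqP def_u].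
    have: v \in [set u; clear_bit u i] by rewrite eq_e set21.
    rewrite !inE => /orP[/eqP//|/eqP def_v].
    by move: vj; rewrite def_v def_u !tnth_clear_bit eqxx andbF.
  rewrite -{v}eq_uv in vj eq_e *.
  have: clear_bit u i \in [set u; clear_bit u j] by rewrite -eq_e set22.
  rewrite !inE => /orP[/eqP eq_u|/eqP eq_c].
    by move: ui; rewrite -eq_u tnth_clear_bit eqxx.
  congr (_, _); apply/eqP/negPn/negP => neq_ij.
  have := congr1 (fun w => tnth w i) eq_c.
  by rewrite !tnth_clear_bit eqxx ui neq_ij.
rewrite -sum1_card (eq_bigl (fun p => (p.1 \in V) && tnth p.1 p.2)); last first.
  by move=> p; rewrite inE.
rewrite -(pair_big_dep (mem V) (fun u i => tnth u i) (fun _ _ => 1)) /=.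
apply: eq_bigr => u _.
rewrite sum1_count -[in RHS](map_tnth_enum u) count_map.
by rewrite enumT.
Qed.

End EdgeCount.

End Counting.

(** * Positivity of the denominator *)

Lemma edge_denominator_gt0 (k : nat) : (2 <= k)%N ->
  ((k + 1) ^ k.+1 < 2 * (2 * k) ^ k)%N.
Proof.
move=> hk.
have bernoulli (b c m : nat) :
    (b ^ m.+1 + m.+1 * c * b ^ m <= (b + c) ^ m.+1)%N.
  elim: m => [|m IHm]; first by rewrite !expn1 expn0; lia.
  rewrite [in leqRHS]expnS (leq_trans _ (leq_mul (leqnn (b + c)) IHm)) //.
  rewrite !expnS; set x := (b ^ m)%N; nia.
(* The choice [b = k + 1], [c = k - 1] gives [b + c = 2 * k]. After division by [(k + 1) ^ (k - 1)]
   there remains [(k + 1) ^ 2 < 2 * (k + 1) + 2 * k * (k - 1)], whose gap is [(k - 1) ^ 2]. *)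
have := bernoulli (k + 1)%N k.-1 k.-1.
rewrite prednK; last by lia.
have -> : (k + 1 + k.-1 = 2 * k)%N by lia.
case: k hk {bernoulli} => [|k] // hk /=.
rewrite [((_ + 1) ^ k.+2)%N]expnS [((_ + 1) ^ k.+1)%N]expnS.
have : (0 < (k.+1 + 1) ^ k)%N by rewrite expn_gt0; lia.
set x := ((k.+1 + 1) ^ k)%N; set y := (_ ^ k.+1)%N; nia.
Qed.

(** * The Fibonacci sequence extended backwards *)

(* [shifted_kfib k m] is the value at [m - k] of the two-sided sequence. *)
Definition shifted_kfib (k m : nat) : rat :=
  if (m < k)%N then (m == k.-1)%:R - (m == k.-2)%:R else (kfib k (m - k))%:R.

Lemma shifted_kfibD (k m : nat) : shifted_kfib k (m + k) = (kfib k m)%:R.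
Proof. by rewrite /shifted_kfib ltnNge leq_addl addnK. Qed.

Lemma sum_delta (R : nzRingType) (k a m : nat) :
  \sum_(i < k) ((m + i)%N == a)%:R = ((m <= a < m + k)%N)%:R :> R.
Proof.
elim: k => [|k IHk]; first by rewrite big_ord0 addn0 ltnNge andbN.
rewrite big_ord_recr IHk /= -natrD; congr _%:R.
rewrite addnS ltnS; have [] := leqP m a; have [] := ltngtP a (m + k)%N; lia.
Qed.

Lemma shifted_kfib_rec (k m : nat) : (2 <= k)%N ->
  shifted_kfib k (m + k) = \sum_(i < k) shifted_kfib k (m + i).
Proof.
move=> hk; have [ltmk|lekm] := ltnP m k; last first.
  rewrite shifted_kfibD kfib_rec //; last by lia.
  rewrite natr_sum big_add1 big_mkord (reindex_inj rev_ord_inj) /=.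
  apply: eq_bigr => i _; have lti := ltn_ord i.
  rewrite /shifted_kfib ifF; last by lia.
  by congr (kfib k _)%:R; lia.
(* For [m < k] the delta form also holds from index [k] on, since [kfib] is still 0 there. The
   window always contains the 1 at [k.-1], and it contains the -1 at [k.-2] unless [m = k.-1]. *)
rewrite (eq_bigr (fun i : 'I_k =>
    ((m + i)%N == k.-1)%:R - ((m + i)%N == k.-2)%:R)) => [|i _]; last first.
  have lti := ltn_ord i; rewrite /shifted_kfib; case: ltnP => // leki.
  rewrite kfib_small; last by lia.
  have -> : (m + i == k.-1)%N = false by lia.
  by have -> : (m + i == k.-2)%N = false by lia.
rewrite big_split /= sumrN !sum_delta shifted_kfibD.
have [->|neq] := eqVneq m k.-1.
  rewrite kfib_pred.
  have -> : (k.-1 <= k.-1 < k.-1 + k)%N by lia.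
  by have -> : (k.-1 <= k.-2)%N = false by lia.
rewrite kfib_small; last by lia.
have -> : (m <= k.-1 < m + k)%N by lia.
by have -> : (m <= k.-2 < m + k)%N by lia.
Qed.

(** Two consecutive windows differ only in their end terms. *)
Lemma shifted_kfib_recS (k m : nat) : (2 <= k)%N ->
  shifted_kfib k (m + k).+1 = 2 * shifted_kfib k (m + k) - shifted_kfib k m.
Proof.
move=> hk; have := shifted_kfib_rec m.+1 hk; have := shifted_kfib_rec m hk.
case: k hk => // k hk.
rewrite big_ord_recl big_ord_recr /= addn0.
rewrite (eq_bigr (fun i : 'I_k => shifted_kfib k.+1 (m.+1 + i))); last first.
  by move=> i _; rewrite /bump /= add1n addSnnS.
by move=> rec recS; rewrite -addSn recS (addSnnS m k) rec; ring.
Qed.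

(** * Summation by parts for weighted Fibonacci sums *)

Section Weighted.
Variables (k : nat) (hk : (2 <= k)%N).
Local Notation f := (shifted_kfib k).
Local Notation a := (2 * k%:R : rat).
Local Notation b := (k%:R + 1 : rat).

(** Unlike that of [f], the argument is not shifted by [k]: this is H_m, the sum of i F_(m-i) over 1
    <= i <= k. *)
Definition weighted_kfib (m : nat) : rat :=
  \sum_(i < k) (i.+1)%:R * f (m + k.-1 - i).

Local Notation H := weighted_kfib.

Lemma sum_rev_shifted_kfib (m : nat) :
  \sum_(i < k) f (m + k.-1 - i) = f (m + k).
Proof.
rewrite shifted_kfib_rec // (reindex_inj rev_ord_inj) /=; apply: eq_bigr => i _.
by congr f; have := ltn_ord i; lia.
Qed.

(** Advancing the window raises each weight by one, which adds a full Fibonacci window, and drops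
    [f m] with weight [k]; [shifted_kfib_recS] then eliminates [f m]. *)
Lemma weighted_kfibS (m : nat) : H m.+1 = H m + b * f (m + k).+1 - a * f (m + k).
Proof.
suff: H m.+1 = H m + f (m + k).+1 - k%:R * f m.
  by move=> ->; rewrite shifted_kfib_recS //; ring.
rewrite -addSn -sum_rev_shifted_kfib /H.
case: k hk => // l _ /=.
rewrite big_ord_recl [\sum_(i < l.+1) i.+1%:R * _]big_ord_recr /=.
rewrite [\sum_(i < l.+1) shifted_kfib _ _]big_ord_recl /= addnK !subn0.
rewrite (eq_bigr (fun i : 'I_l =>
  i.+1%:R * shifted_kfib l.+1 (m + l - i)
  + shifted_kfib l.+1 (m.+1 + l - bump 0 i))); last first.
  move=> i _; rewrite /bump /= add1n addSn subSS -[i.+2%:R]natr1; ring.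
rewrite big_split /=; ring.
Qed.

Lemma weighted_kfib_rec (m : nat) : \sum_(j < k) H (m + j) = H (m + k).
Proof.
rewrite /H exchange_big /=; apply: eq_bigr => i _.
rewrite -mulr_sumr; congr (_ * _).
have lti := ltn_ord i.
have -> : (m + k + k.-1 - i = (m + k.-1 - i) + k)%N by lia.
rewrite shifted_kfib_rec //; apply: eq_bigr => j _.
by congr f; lia.
Qed.

(** Telescoping [weighted_kfibS] over [k] steps leaves a full window, which the recurrence closes;
    then [2 * b - a = 2]. *)
Lemma weighted_kfibD (m : nat) :
  H (m + k) - H m = 2 * f (m + k + k) - b * f (m + k).
Proof.
have part l : H (m + l) - H m =
    b * (f (m + k + l) - f (m + k)) + (b - a) * \sum_(j < l) f (m + k + j).
  elim: l => [|l IHl]; first by rewrite !addn0 big_ord0; ring.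
  rewrite big_ord_recr /= !addnS weighted_kfibS.
  rewrite (_ : (m + l + k = m + k + l)%N); last by lia.
  move: IHl => /(congr1 (fun x => x + H m)); rewrite subrK => ->; ring.
by rewrite part -shifted_kfib_rec //; ring.
Qed.

(** As [k - 1 = a - b], summation by parts applies to the geometric weights, and the form of the
    increments of [H] makes the remaining sum telescope too. *)
Lemma geometric_weighted_kfib (m : nat) :
  (k%:R - 1) * \sum_(j < k) b ^+ j * a ^+ (k - j - 1) * H (m + j) =
  a ^+ k * H m - b ^+ k * H (m + k)
  + b * (b ^+ k * f (m + k + k) - a ^+ k * f (m + k)).
Proof.
have part l : (k%:R - 1) * \sum_(j < l) b ^+ j * a ^+ (l - j - 1) * H (m + j) =
    a ^+ l * H m - b ^+ l * H (m + l)
    + b * (b ^+ l * f (m + k + l) - a ^+ l * f (m + k)).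
  elim: l => [|l IHl]; first by rewrite big_ord0 !addn0; ring.
  rewrite big_ord_recr /= mulrDr subSnn subnn expr0 mulr1.
  rewrite (eq_bigr (fun j : 'I_l => a * (b ^+ j * a ^+ (l - j - 1) * H (m + j)))).
    rewrite -mulr_sumr mulrCA IHl !addnS weighted_kfibS.
    rewrite (_ : (m + l + k = m + k + l)%N); last by lia.
    by rewrite !exprS; ring.
  move=> j _; have ltj := ltn_ord j.
  by rewrite (_ : (l.+1 - j - 1 = (l - j - 1).+1)%N) ?exprS; [ring|lia].
exact: part.
Qed.

(** Source of the denominator: the part of [edge_coefA] constant in [j] gives [H (m + k)], the
    geometric part gives boundary terms, and [weighted_kfibD] merges them. *)
Lemma sum_edge_coefA (m : nat) :
  \sum_(j < k) edge_coefA k j * H (m + j) =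
  (2 * a ^+ k - b ^+ k.+1) * (H (m + k) - f (m + k + k)).
Proof.
rewrite (eq_bigr (fun j : 'I_k => (a ^+ k - k%:R * b ^+ k) * H (m + j)
  + (k%:R - 1) * (b ^+ j * a ^+ (k - j - 1) * H (m + j)))); last first.
  by move=> j _; rewrite /edge_coefA; ring.
rewrite big_split /= -!mulr_sumr weighted_kfib_rec geometric_weighted_kfib.
have /(congr1 (fun x => x + H m)) := weighted_kfibD m; rewrite subrK => ->.
by rewrite exprS; ring.
Qed.

(** * The right-hand side of the formula *)

(** The index [m] stands for the order m - k, negative when [m < k]; the subtraction takes place in
    [rat], without truncation. *)
Definition edge_formula (m : nat) : rat :=
  \sum_(j < k) ((m%:R - k%:R) * edge_coefA k j + edge_coefB k j) * f (m + j).

(** As [f] obeys the homogeneous recurrence, the only defect comes from the order, which drops by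
    [i.+1] in the [i]-th term; the drops assemble into the sums [H (m + j)] weighted by
    [edge_coefA]. *)
Lemma edge_formula_rec (m : nat) :
  edge_formula (m + k) = \sum_(i < k) edge_formula (m + k.-1 - i)
  + (2 * a ^+ k - b ^+ k.+1) * \sum_(i < k) i%:R * f (m + k + k.-1 - i).
Proof.
have -> : \sum_(i < k) i%:R * f (m + k + k.-1 - i) = H (m + k) - f (m + k + k).
  rewrite -sum_rev_shifted_kfib /H -sumrB; apply: eq_bigr => i _.
  by rewrite -natr1; ring.
rewrite -sum_edge_coefA /edge_formula [X in _ = X + _]exchange_big /=.
rewrite -big_split /=; apply: eq_bigr => j _.
rewrite /H mulr_sumr -big_split /= -addnA [(k + j)%N]addnC addnA.
rewrite -sum_rev_shifted_kfib mulr_sumr; apply: eq_bigr => i _.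
have lti := ltn_ord i.
rewrite (_ : (m + k.-1 - i + j = m + j + k.-1 - i)%N); last by lia.
have -> : (m + k)%:R = (m + k.-1 - i)%:R + i.+1%:R :> rat.
  by rewrite -natrD; congr _%:R; lia.
ring.
Qed.

(** With [edge_coefB0], this makes [edge_formula] vanish at negative orders. *)
Lemma edge_coefB_diff (j : nat) : (j.+1 < k)%N ->
  edge_coefB k j.+1 - edge_coefB k j =
  j.+2%:R * (edge_coefA k j.+1 - edge_coefA k j).
Proof.
move=> ltjk; rewrite /edge_coefA /edge_coefB.
rewrite (_ : (k - j - 1 = (k - j.+1 - 1).+1)%N); last by lia.
by rewrite -[j.+2]addn2 -[j.+1%:R]natr1 natrD !exprS; ring.
Qed.

Lemma edge_coefB0 : edge_coefB k 0 = edge_coefA k 0.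
Proof.
rewrite /edge_coefA /edge_coefB subn0 !expr0.
case: k hk => // l _; rewrite subn1 /= !exprS; ring.
Qed.

Lemma edge_formula_small (m : nat) : (m < k)%N -> edge_formula m = 0.
Proof.
move=> ltmk; pose g j : rat := (m%:R - k%:R) * edge_coefA k j + edge_coefB k j.
have pick (l : nat) : \sum_(j < k) g j * (m + j == l)%N%:R =
    if (m <= l < m + k)%N then g (l - m)%N else 0.
  case: ifP => [/andP[le_ml lt_l]|out].
    have ltk : (l - m < k)%N by lia.
    rewrite (bigD1 (Ordinal ltk)) //= subnKC // eqxx mulr1 big1 ?addr0 // => j.
    by rewrite -val_eqE /= => neq; rewrite (_ : (_ == _) = false) ?mulr0 //; lia.
  rewrite big1 // => j _; have ltj := ltn_ord j.
  by rewrite (_ : (_ == _) = false) ?mulr0 //; lia.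
(* Only two entries of [f] survive, so the value is [g (k.-1 - m) - g (k.-2 - m)], without the
   second term when [m = k.-1]. *)
transitivity (\sum_(j < k) (g j * (m + j == k.-1)%N%:R - g j * (m + j == k.-2)%N%:R)).
  apply: eq_bigr => j _; have ltj := ltn_ord j.
  rewrite -mulrBr; congr (_ * _); rewrite /shifted_kfib; case: ltnP => // lek.
  rewrite kfib_small; last by lia.
  have -> : (m + j == k.-1)%N = false by lia.
  by have -> : (m + j == k.-2)%N = false by lia.
rewrite sumrB !pick /g.
rewrite ifT; last by lia.
case: ifP => [/andP[le_m _]|]; last first.
  move=> out; have -> : m = k.-1 by lia.
  rewrite subnn edge_coefB0 -[in k%:R](prednK (ltnW hk)) -natr1; ring.
(* For [j = k.-2 - m], the factor [j.+2] in [edge_coefB_diff] is [k - m] and cancels the order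
   [m - k]. *)
have -> : (k.-1 - m = (k.-2 - m).+1)%N by lia.
have lt1 : ((k.-2 - m).+1 < k)%N by lia.
have /(congr1 (fun x => x + edge_coefB k (k.-2 - m))) := edge_coefB_diff lt1.
rewrite subrK => ->.
have -> : k%:R = m%:R + (k.-2 - m).+2%:R :> rat by rewrite -natrD; congr _%:R; lia.
ring.
Qed.
End Weighted.

(** * Agreement of the two sides *)

Lemma shifted_ones_formula (k m : nat) : (2 <= k)%N ->
  (2 * (2 * k%:R) ^+ k - (k%:R + 1) ^+ k.+1) * (shifted_ones k m)%:R =
  edge_formula k m.
Proof.
move=> hk; elim/ltn_ind: m => m IHm; have [ltmk|lekm] := ltnP m k.
  by rewrite edge_formula_small // /shifted_ones ltmk mulr0.
rewrite -(subnK lekm) in IHm *; move: (m - k)%N IHm => {lekm} {}m IHm.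
rewrite edge_formula_rec // shifted_ones_rec; last by lia.
rewrite natr_sum !mulr_sumr -big_split /=; apply: eq_bigr => i _.
have lti := ltn_ord i; rewrite -IHm; last by lia.
rewrite natrD natrM mulrDr; congr (_ + _ * (_ * _)).
rewrite -shifted_kfibD; congr shifted_kfib; lia.
Qed.

Theorem theorem3p6 (k n : nat) (hk : (2 <= k)%N) (hn : (k <= n)%N) :
  #|fibcube_edges k n|%:R =
    1 / (2 * (2 * k%:R) ^+ k - (k%:R + 1) ^+ k.+1)
    * \sum_(j < k) (n%:R * edge_coefA k j + edge_coefB k j) * (kfib k (n + j))%:R :> rat.
Proof.
have D_neq0 : 2 * (2 * k%:R) ^+ k - (k%:R + 1) ^+ k.+1 != 0 :> rat.
  have /gtn_eqF/negbT := edge_denominator_gt0 hk.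
  by rewrite -(@Num.Theory.eqr_nat rat) -subr_eq0 natrM !natrX natrM natrD.
have -> : #|fibcube_edges k n| = shifted_ones k (n + k).
  rewrite card_fibcube_edges /shifted_ones ltnNge leq_addl addnK.
  by apply: eq_bigl => u; rewrite inE.
have -> : \sum_(j < k) (n%:R * edge_coefA k j + edge_coefB k j)
    * (kfib k (n + j))%:R = edge_formula k (n + k).
  apply: eq_bigr => j _.
  by rewrite natrD addrK -addnA [(k + j)%N]addnC addnA shifted_kfibD.
by rewrite -shifted_ones_formula // div1r mulKf.
Qed.
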